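(* Let $\mathcal{A}$ be a complex unital $C^*$-algebra, let $a\in\mathcal{A}$ be a non-zero positive element, and let $0\le\alpha\le 1$. Then the following hold. (a) If $x\in\mathcal{A}_a$ and $x^{\#_a}$ is an $a$-adjoint of $x$, then $$v_a^2(x)\le \big\|\alpha x^{\#_a}x+(1-\alpha)xx^{\#_a}\big\|_a .$$ (b) If $x\in\mathcal{A}$ and $\phi$ is an Orlicz function, then $$\phi\big(v^2(x)\big)\le \big\|\alpha\phi(x^*x)+(1-\alpha)\phi(xx^* )\big\| .$$
   Context: $\mathbf 1$ is the unit of $\mathcal{A}$. A functional $f\in\mathcal{A}^*$ is positive ($f\ge 0$) if $f(x^*x)\ge 0$ for all $x\in\mathcal{A}$. $\mathcal{S}(\mathcal{A})=\{g\in\mathcal{A}^*: g\ge0,\ g(\mathbf 1)=1\}$ is the set of states and $v(x)=\sup\{|g(x)|: g\in\mathcal{S}(\mathcal{A})\}$ is the (algebraic) numerical radius. For a non-zero positive $a\in\mathcal{A}$: $\mathcal{S}_a(\mathcal{A})=\{f\in\mathcal{A}^*: f\ge0,\ f(a)=1\}$; the $a$-numerical radius is $v_a(x)=\sup\{|f(ax)|: f\in\mathcal{S}_a(\mathcal{A})\}$; and $\|x\|_a=\sup\{\sqrt{f(x^*ax)}: f\in\mathcal{S}_a(\mathcal{A})\}$ (possibly $+\infty$ in general, but finite on $\mathcal{A}_a$). An $a$-adjoint of $x\in\mathcal{A}$ is an element $x^{\#_a}\in\mathcal{A}$ with $ax^{\#_a}=x^*a$ (it need not exist or be unique); $\mathcal{A}_a$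 is the set of all elements of $\mathcal{A}$ that have an $a$-adjoint. The notation $v_a^2(x)$ means $(v_a(x))^2$, and similarly for $v$. An Orlicz function is a map $\phi:[0,\infty)\to[0,\infty)$ that is continuous, convex, non-decreasing, with $\phi(0)=0$ and $\phi(u)\to\infty$ as $u\to\infty$; it is always assumed non-degenerate, i.e. $\phi(u)>0$ for $u>0$. For a positive element $y$, $\phi(y)$ is defined by continuous functional calculus. *)

(* Defs.v *)
From HB Require Import structures.
From mathcomp Require Import all_boot all_order all_algebra.
From mathcomp Require Import all_classical all_reals all_analysis.
From mathcomp Require Import complex.
Set Implicit Arguments.
Unset Strict Implicit.
Unset Printing Implicit Defensive.
Import Order.TTheory GRing.Theory Num.Theory numFieldNormedType.Exports.
Local Open Scope classical_set_scope.
Local Open Scope ring_scope.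
Local Open Scope complex_scope.

Definition modulus (R : realType) (z : R[i]) : R := complex.Re `|z|.

(* The hierarchy has no join of normed modules and rings below NumDomain and
   cannot be extended with one, so the norm is part of the mixin; it takes real
   values, and completeness is stated for Cauchy sequences. *)
HB.mixin Record isCStarAlgebra (R : realType) (A : Type)
    of GRing.Algebra R[i] A := {
  cnorm : A -> R ;
  cnorm0_eq0 : forall x : A, cnorm x = 0 -> x = 0 ;
  cnormZ : forall (c : R[i]) (x : A), cnorm (c *: x) = modulus c * cnorm x ;
  ler_cnormD : forall x y : A, cnorm (x + y) <= cnorm x + cnorm y ;
  ler_cnormM : forall x y : A, cnorm (x * y) <= cnorm x * cnorm y ;
  cnorm_complete : forall u : nat -> A,
    (forall e : R, 0 < e -> exists N : nat, forall m n : nat,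
       (N <= m)%N -> (N <= n)%N -> cnorm (u m - u n) < e) ->
    exists l : A, forall e : R, 0 < e -> exists N : nat, forall n : nat,
       (N <= n)%N -> cnorm (u n - l) < e ;
  star : A -> A ;
  starK : forall x : A, star (star x) = x ;
  starD : forall x y : A, star (x + y) = star x + star y ;
  starZ : forall (c : R[i]) (x : A), star (c *: x) = Num.conj c *: star x ;
  starM : forall x y : A, star (x * y) = star y * star x ;
  cnorm_starM : forall x : A, cnorm (star x * x) = cnorm x ^+ 2
}.

#[short(type="cstarAlgType")]
HB.structure Definition CStarAlgebra (R : realType) :=
  {A of GRing.Algebra R[i] A & isCStarAlgebra R A}.

Section CStarNotions.
Variables (R : realType) (A : cstarAlgType R).
Implicit Types (a x y b : A) (f g : {linear A -> R[i]^o}).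

Definition positive_elt x : Prop := exists b, x = star b * b.

(* An element of the dual is a bounded linear functional.  In R[i], [0 <= z]
   means that z is real and nonnegative. *)
Definition positive_functional f : Prop :=
  (exists M : R, forall x, modulus (f x) <= M * cnorm x) /\
  forall x, 0 <= (f (star x * x) : R[i]).

Definition states : set {linear A -> R[i]^o} :=
  [set g | positive_functional g /\ g 1 = 1].

Definition states_of a : set {linear A -> R[i]^o} :=
  [set f | positive_functional f /\ f a = 1].

(* The set on the right is bounded above by the norm of x, so that the real
   supremum is the actual one. *)
Definition numradius x : R := sup [set modulus (g x) | g in states].

(* Supremum in [0, +oo] (where the empty set has supremum 0), for sets of
   nonnegative extended reals. *)
Definition sup_ge0 (S : set (\bar R)) : \bar R := maxe 0%E (ereal_sup S).

Definition anumradius a x : \bar R :=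
  sup_ge0 [set (modulus (f (a * x)))%:E | f in states_of a].

(* f (x^* a x) is real and nonnegative for positive a and f. *)
Definition anorm a x : \bar R :=
  sup_ge0 [set (Num.sqrt (complex.Re (f (star x * a * x))))%:E
          | f in states_of a].

Definition aadjoint a x y : Prop := a * y = star x * a.

Definition aadjointable a : set A := [set x | exists y, aadjoint a x y].

Definition invertible x : Prop := exists y, y * x = 1 /\ x * y = 1.

Definition spectrum x : set R[i]^o := [set l | ~ invertible (x - l%:A)].

(* The continuous functional calculus of y is the unital *-homomorphism
   Phi : C(sigma(y)) -> A with Phi(id) = y (unique, and existing exactly for
   normal y).  An element of C(sigma(y)) is represented by any function
   on the complex plane whose restriction to sigma(y) is continuous; Phi only
   depends on that restriction. *)
Record functional_calculus y (Phi : (R[i]^o -> R[i]^o) -> A) : Prop := {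
  fcalc_ext : forall F G : R[i]^o -> R[i]^o,
    {within spectrum y, continuous F} ->
    (forall l, spectrum y l -> F l = G l) -> Phi F = Phi G ;
  fcalcD : forall F G : R[i]^o -> R[i]^o,
    {within spectrum y, continuous F} -> {within spectrum y, continuous G} ->
    Phi (fun l => F l + G l) = Phi F + Phi G ;
  fcalcM : forall F G : R[i]^o -> R[i]^o,
    {within spectrum y, continuous F} -> {within spectrum y, continuous G} ->
    Phi (fun l => (F l : R[i]) * (G l : R[i])) = Phi F * Phi G ;
  fcalcZ : forall (c : R[i]) (F : R[i]^o -> R[i]^o),
    {within spectrum y, continuous F} -> Phi (fun l => c *: F l) = c *: Phi F ;
  fcalc_star : forall F : R[i]^o -> R[i]^o,
    {within spectrum y, continuous F} ->
    Phi (fun l => Num.conj (F l : R[i])) = star (Phi F) ;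
  fcalc1 : Phi (fun=> 1) = 1 ;
  fcalc_id : Phi id = y
}.

(* [fcalc_value phi y b] is "b = phi(y)" for positive y and a function phi on
   [0, +oo[.  The spectrum of a positive y lies in [0, +oo[, where the modulus
   is the identity: only the values of phi on the spectrum matter. *)
Definition fcalc_value (phi : R -> R) y b : Prop :=
  exists2 Phi : (R[i]^o -> R[i]^o) -> A,
    functional_calculus y Phi &
    b = Phi (fun l => (phi (modulus l))%:C).

End CStarNotions.

(* Only the restriction of phi to [0, +oo[ is constrained. *)
Record orlicz (R : realType) (phi : R -> R) : Prop := {
  orlicz_ge0 : forall u, 0 <= u -> 0 <= phi u ;
  orlicz_continuous : {within `[0, +oo[, continuous phi} ;
  orlicz_convex : convex_function (`[0, +oo[%classic : set R) phi ;
  orlicz_homo : {in `[0, +oo[ &, {homo phi : u v / u <= v}} ;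
  orlicz0 : phi 0 = 0 ;
  orlicz_cvgy : phi u @[u --> +oo] --> +oo ;
  orlicz_gt0 : forall u, 0 < u -> 0 < phi u
}.

(* Main.v *)
Require Import Defs.
From HB Require Import structures.
From mathcomp Require Import all_boot all_order all_algebra.
From mathcomp Require Import all_classical all_reals all_analysis.
From mathcomp Require Import complex ring lra.
Set Implicit Arguments.
Unset Strict Implicit.
Unset Printing Implicit Defensive.
Import Order.TTheory GRing.Theory Num.Theory numFieldNormedType.Exports.
Local Open Scope classical_set_scope.
Local Open Scope ring_scope.
Local Open Scope complex_scope.

(* A positive functional f is hermitian and satisfies Cauchy-Schwarz.
   (a) For f(a) = 1, Cauchy-Schwarz for <u, v> = f(u^* a v) bounds |f(ax)|^2 by
   f(x^* a x) = f(a xs x), and applied to xs it bounds the same quantity by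
   f(a x xs).  So |f(ax)|^2 is at most f(aw) for the convex combination w, and
   f(aw) <= sqrt (f(w^* a w)) by Cauchy-Schwarz again.
   (b) A line below phi that touches it at r^2, with r = v(x), has a slope
   c >= 0; through the functional calculus and a state g it gives
   phi(r^2) + c (g(x^* x) - r^2) <= g(phi(x^* x)), and the same for x x^*.
   As both g(x^* x) and the value of g at x x^* dominate |g(x)|^2, and g is
   contractive, phi(r^2) + c (|g(x)|^2 - r^2) is at most the norm on the
   right-hand side for every state g; take the supremum over g. *)

(** * Modulus, conjugation and continuity on the complex plane *)

Lemma sqr_modulus (R : realType) (z : R[i]) :
  modulus z ^+ 2 = complex.Re z ^+ 2 + complex.Im z ^+ 2.
Proof. by rewrite /modulus normc_def /= sqr_sqrtr// addr_ge0 ?sqr_ge0. Qed.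

Lemma modulus_ge0 (R : realType) (z : R[i]) : 0 <= modulus z.
Proof. by rewrite /modulus normc_def sqrtr_ge0. Qed.

Lemma modulusJ (R : realType) (z : R[i]) : modulus (Num.conj z) = modulus z.
Proof. by rewrite /modulus norm_conjC. Qed.

Lemma Re_le_modulus (R : realType) (z : R[i]) : complex.Re z <= modulus z.
Proof.
by have := normc_ge_Re z; rewrite lecE => /andP[_]; apply/le_trans/ler_norm.
Qed.

Lemma lipschitz_continuous (R : realType) (h : R[i]^o -> R) :
  (forall l m, `|h l - h m| <= modulus (l - m)) -> continuous h.
Proof.
move=> hl l; apply/(@cvgrPdist_lt _ _ _ _ (nbhs_filter l)) => e e0.
(* The norm of [R[i]^o] is complex-valued, so the radius of the ball is [e%:C]. *)
have e0' : 0 < e%:C :> R[i] by rewrite ltcR.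
exists e%:C => //= m lm; apply: le_lt_trans (hl l m) _.
by move: lm; rewrite /= ltcE => /andP[].
Qed.

Lemma continuous_conj (R : realType) :
  continuous (fun l : R[i]^o => Num.conj (l : R[i]) : R[i]^o).
Proof.
move=> l; apply/(@cvgrPdist_lt _ _ _ _ (nbhs_filter l)) => e e0.
by exists e => //= m; rewrite -rmorphB norm_conjC.
Qed.

Lemma continuous_Re (R : realType) : continuous (@complex.Re R : R[i]^o -> R).
Proof.
apply: lipschitz_continuous => l m.
have := normc_ge_Re (l - m); rewrite lecE /= => /andP[_].
by case: l m => [? ?] [? ?].
Qed.

Lemma continuous_modulus (R : realType) : continuous (@modulus R : R[i]^o -> R).
Proof.
apply: lipschitz_continuous => l m.
have D (u v : R[i]) : modulus u <= modulus (u - v) + modulus v.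
  have := ler_normD (u - v) v; rewrite subrK lecE => /andP[_].
  by rewrite raddfD.
rewrite ler_norml; have := D l m; have := D m l.
have -> : modulus (m - l) = modulus (l - m) by rewrite /modulus distrC.
by move=> h1 h2; apply/andP; split; lra.
Qed.

Lemma continuous_real_complex (R : realType) :
  continuous (@real_complex R : R -> R[i]^o).
Proof.
move=> u; apply/cvgrPdist_lt => -[e e'].
rewrite ltcE /= => /andP[/eqP -> e0].
near=> v; rewrite -rmorphB /= normc_def /= expr0n addr0 sqrtr_sqr ltcR.
by near: v; exists e.
Unshelve. all: by end_near. Qed.

(** The modulus takes values in [[0, +oo[], so continuity within that half-line is enough. *)
Lemma continuous_comp_modulus (R : realType) (phi : R -> R) :
  {within `[0, +oo[, continuous phi} ->
  continuous (fun l : R[i]^o => phi (modulus l)).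
Proof.
move=> /subspace_continuousP phi_cont l.
have l0 : `[0, +oo[%classic (modulus l) by rewrite /= in_itv /= modulus_ge0.
apply: cvg_comp (phi_cont _ l0) => B /= hB.
apply: (@filterS _ _ (nbhs_filter l) _ _ _ (continuous_modulus hB)) => m /=.
by apply; rewrite in_itv /= modulus_ge0.
Qed.

(** * Norm, positive functionals and Cauchy-Schwarz *)

Section cstar.
Variables (R : realType) (A : cstarAlgType R).
Implicit Types (x y w : A) (f g : {linear A -> R[i]^o}).

Lemma cnormN x : cnorm (- x) = cnorm x.
Proof. by rewrite -scaleN1r cnormZ /modulus normrN1 mul1r. Qed.

Lemma cnorm0 : cnorm (0 : A) = 0.
Proof. by rewrite -(scale0r (0 : A)) cnormZ /modulus normr0 mul0r. Qed.

Lemma cnorm_ge0 x : 0 <= cnorm x.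
Proof. by have := ler_cnormD x (- x); rewrite subrr cnorm0 cnormN; lra. Qed.

Lemma star1 : star (1 : A) = 1.
Proof. by rewrite -[LHS]mulr1 -[X in _ * X](starK 1) -starM mulr1 starK. Qed.

Lemma functional_sqrD f u v (c : R[i]) :
  f (star (u + c *: v) * (u + c *: v)) =
  f (star u * u) + c * f (star u * v) + Num.conj c * f (star v * u)
  + c * Num.conj c * f (star v * v) :> R[i].
Proof.
rewrite starD starZ mulrDl !mulrDr -!scalerAl -!scalerAr !linearD /=.
rewrite !linearZ /= /GRing.scale /=.
ring.
Qed.

(** Polarization: positivity makes the expansion at [u + c *: v] real. The choice [c = 1] yields the
    imaginary part of the identity, [c = 'i] the real part. *)
Lemma positive_functional_conj f u v : positive_functional f ->
  f (star v * u) = Num.conj (f (star u * v) : R[i]).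
Proof.
move=> [_ f0].
have p := f0 u; have q := f0 v.
have h1 := f0 (u + 1 *: v); have hi := f0 (u + 'i%C *: v).
move: p q h1 hi; rewrite !functional_sqrD.
case: (f (star u * u)) (f (star v * v)) (f (star u * v)) (f (star v * u))
  => [p p'] [q q'] [z z'] [t t'].
rewrite !lecE /= => /andP[/eqP p0 _] /andP[/eqP q0 _] /andP[/eqP h1 _].
move=> /andP[/eqP h2 _].
apply/eqP; rewrite eq_complex/=; apply/andP; split; apply/eqP; lra.
Qed.

(** The discriminant argument of Cauchy-Schwarz, with [n] the squared modulus of the cross term; for
    positive [q] and [n] the minimum is at [q^-1]. *)
Lemma le_of_quadratic_ge0 (p q n : R) : 0 <= n -> 0 <= q ->
  (forall t : R, 0 <= p - 2 * t * n + t ^+ 2 * n * q) -> n <= p * q.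
Proof.
rewrite le0r => /predU1P[-> | n0].
  by move=> q0 /(_ 0) p0; rewrite mulr_ge0//; lra.
(* For [q = 0] the expression is affine in [t], and the chosen point gives it the value -1. *)
rewrite le0r => /predU1P[-> /(_ ((p + 1) / (2 * n))) | q0 /(_ q^-1)].
  rewrite (_ : _ + _ = -1) ?oppr_ge0 ?ler10//; field.
  by rewrite ?gt_eqF.
rewrite (_ : _ + _ = p - n / q); last by field; rewrite gt_eqF.
by rewrite subr_ge0 ler_pdivrMr.
Qed.

Lemma positive_functional_star f x : positive_functional f ->
  f (star x) = Num.conj (f x : R[i]).
Proof.
by move=> /(positive_functional_conj 1 x); rewrite star1 mulr1 mul1r.
Qed.

Lemma Re_functional_ge0 f x : positive_functional f ->
  0 <= complex.Re (f (star x * x)).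
Proof. by case=> _ /(_ x); rewrite lecE => /andP[]. Qed.

Lemma positive_functional_CauchySchwarz f u v : positive_functional f ->
  modulus (f (star u * v)) ^+ 2 <=
  complex.Re (f (star u * u)) * complex.Re (f (star v * v)).
Proof.
move=> fp.
apply: le_of_quadratic_ge0; rewrite ?sqr_ge0 ?Re_functional_ge0// => t.
(* This makes both cross terms equal to [- t] times the squared modulus of [f (star u * v)]. *)
pose c := - t%:C * Num.conj (f (star u * v) : R[i]).
have := Re_functional_ge0 (u + c *: v) fp; rewrite /c.
rewrite functional_sqrD (positive_functional_conj u v fp) sqr_modulus.
case: (f (star u * u)) (f (star v * v)) (f (star u * v)) (fp.2 v)
  => [p p'] [q q'] [z z'].
rewrite !lecE /= => /andP[/eqP -> _].
by congr (_ <= _); ring.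
Qed.

Lemma state_sqr_le f x : states f ->
  modulus (f x) ^+ 2 <= complex.Re (f (star x * x)).
Proof.
move=> [fp f1]; have := positive_functional_CauchySchwarz 1 x fp.
by rewrite star1 !mul1r f1 mul1r.
Qed.

Lemma state_sqr_le_adj f x : states f ->
  modulus (f x) ^+ 2 <= complex.Re (f (x * star x)).
Proof.
move=> fs; have := state_sqr_le (star x) fs.
by rewrite (positive_functional_star x fs.1) modulusJ starK.
Qed.

(* The bound [1 + e] on all of [A] self-improves to [1 + e / 2], because
   [|f x|^2 <= f (x^* x)] and the norm of [x^* x] is [cnorm x ^+ 2]. *)
Lemma state_contractive f x : states f -> modulus (f x) <= cnorm x.
Proof.
move=> fs; have [[[M fM] _] _] := fs.
pose K := `|M|.
have H n : forall w, modulus (f w) <= (1 + K / 2 ^+ n) * cnorm w.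
  elim: n => [|n IH] w.
    rewrite expr0 divr1; apply: le_trans (fM w) _.
    rewrite ler_wpM2r ?cnorm_ge0//.
    by rewrite (le_trans (ler_norm M))// lerDr ler01.
  set e := K / 2 ^+ n in IH.
  have e0 : 0 <= e by rewrite divr_ge0 ?normr_ge0 ?exprn_ge0.
  have -> : K / 2 ^+ n.+1 = e / 2.
    by rewrite /e exprS invfM mulrA mulrAC.
  rewrite -(@ler_pXn2r _ 2)// ?nnegrE ?modulus_ge0//; last first.
    by rewrite mulr_ge0 ?cnorm_ge0// addr_ge0// divr_ge0.
  apply: le_trans (state_sqr_le w fs) _.
  apply: le_trans (Re_le_modulus _) _.
  apply: le_trans (IH _) _.
  (* What remains is [1 + e <= (1 + e / 2) ^+ 2]. *)
  rewrite cnorm_starM exprMn ler_wpM2r ?sqr_ge0//.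
  by have := sqr_ge0 e; lra.
(* An excess [d] over [cnorm x] is refuted once [2 ^+ n] exceeds [K * cnorm x / d]. *)
rewrite leNgt; apply/negP; rewrite -subr_gt0; set d := _ - _ => d0.
have := upper_nthrootP (leqnn (Num.bound (K * cnorm x / d))).
set n := Num.bound _; rewrite ltr_pdivrMr// => Hn.
have := H n x; rewrite mulrDl mul1r -lerBlDl -/d mulrAC.
by rewrite ler_pdivlMr ?exprn_gt0// mulrC leNgt Hn.
Qed.

(** * Positive elements and the inequality for the [a]-numerical radius *)

Lemma star_positive_elt x : positive_elt x -> star x = x.
Proof. by move=> [b ->]; rewrite starM starK. Qed.

(* Cauchy-Schwarz for the form [<u, v> = f (u^* a v)]. *)
Lemma states_of_sqr_le a f x : positive_elt a -> states_of a f ->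
  modulus (f (a * x)) ^+ 2 <= complex.Re (f (star x * a * x)).
Proof.
move=> [b ab] [fp fa]; have := positive_functional_CauchySchwarz b (b * x) fp.
rewrite !mulrA -ab fa mul1r starM.
by rewrite -[star x * star b * b]mulrA -ab.
Qed.

Lemma states_of_aadjoint_le a f x xs : positive_elt a -> states_of a f ->
  aadjoint a x xs -> modulus (f (a * x)) ^+ 2 <= complex.Re (f (a * (xs * x))).
Proof. by move=> a0 fs axs; rewrite mulrA axs states_of_sqr_le. Qed.

(** Since [a] is self-adjoint, [x] is in turn an [a]-adjoint of [xs]; and [a * xs = star (a * x)],
    so [f] has the same modulus at [a * xs] and at [a * x]. *)
Lemma states_of_aadjoint_le_adj a f x xs : positive_elt a -> states_of a f ->
  aadjoint a x xs -> modulus (f (a * x)) ^+ 2 <= complex.Re (f (a * (x * xs))).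
Proof.
move=> a0 fs axs; have ha := star_positive_elt a0.
have axs' : star xs * a = a * x.
  by rewrite -[LHS]starK starM starK ha axs starM starK ha.
have := states_of_sqr_le xs a0 fs.
rewrite axs' -mulrA axs -[X in star x * X]ha -starM.
by rewrite (positive_functional_star _ fs.1) modulusJ.
Qed.

Lemma Re_functional_mix f (t : R) x y :
  complex.Re (f (t%:C *: x + (1 - t)%:C *: y)) =
  t * complex.Re (f x) + (1 - t) * complex.Re (f y).
Proof.
rewrite linearD !linearZ /= /GRing.scale /=.
by case: (f x) (f y) => [? ?] [? ?] /=; ring.
Qed.

Lemma anumradius_sqr_le a x xs (t : R) : positive_elt a -> 0 <= t <= 1 ->
  aadjoint a x xs ->
  (anumradius a x ^+ 2 <=
     anorm a (t%:C *: (xs * x) + (1 - t)%:C *: (x * xs))%R)%E.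
Proof.
move=> a0 /andP[t0 t1] axs; set w := _ + _.
have key f : states_of a f ->
    ((modulus (f (a * x)) ^+ 2)%:E <= anorm a w)%E.
  move=> fs.
  apply: (@le_trans _ _ (Num.sqrt (complex.Re (f (star w * a * w))))%:E).
    rewrite lee_fin; apply: (@le_trans _ _ (modulus (f (a * w)))).
      apply: le_trans (Re_le_modulus _).
      rewrite /w mulrDr -!scalerAr Re_functional_mix.
      have h1 := states_of_aadjoint_le a0 fs axs.
      have h2 := states_of_aadjoint_le_adj a0 fs axs.
      by nra.
    rewrite -(ger0_norm (modulus_ge0 _)) -sqrtr_sqr ler_wsqrtr//.
    exact: states_of_sqr_le.
  rewrite /anorm /sup_ge0 le_max; apply/orP; right.
  by apply: ereal_sup_ubound; exists f.
(* Only a finite value [r] of the right-hand side matters; then [Num.sqrt r] bounds the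
   [a]-numerical radius, which is therefore finite too. *)
have : (0 <= anorm a w)%E by rewrite /anorm /sup_ge0 le_max lexx.
case: (anorm a w) key => [r| |] key; rewrite ?leey//.
rewrite lee_fin => r0.
have : (anumradius a x <= (Num.sqrt r)%:E)%E.
  rewrite /anumradius /sup_ge0 ge_max lee_fin sqrtr_ge0 /=.
  apply: ge_ereal_sup => _ [f fs <-]; rewrite lee_fin.
  rewrite -(ger0_norm (modulus_ge0 _)) -sqrtr_sqr ler_wsqrtr//.
  by have := key f fs; rewrite lee_fin.
have : (0 <= anumradius a x)%E by rewrite /anumradius /sup_ge0 le_max lexx.
case: (anumradius a x) => [s| |]//; rewrite !lee_fin => s0 sr.
rewrite -[leLHS]/(s ^+ 2) -(sqr_sqrtr r0).
by rewrite ler_pXn2r// nnegrE// sqrtr_ge0.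
Qed.

(** * Functional calculus under positive functionals *)

(** The real square root [H] of [h] turns the image of [h] into [star (Phi H) * Phi H]. *)
Lemma fcalc_ge0 y Phi f (h : R[i]^o -> R) : functional_calculus y Phi ->
  positive_functional f -> continuous h -> (forall l, 0 <= h l) ->
  0 <= complex.Re (f (Phi (fun l => (h l)%:C))).
Proof.
move=> P fp hc h0.
pose H l : R[i]^o := (Num.sqrt (h l))%:C.
have Hc : {within spectrum y, continuous H}.
  apply: continuous_subspaceT => l; apply: continuous_comp; last first.
    exact: continuous_real_complex.
  by apply: continuous_comp; [exact: hc | exact: sqrt_continuous].
have HJ : (fun l => Num.conj (H l : R[i])) = H.
  by apply/funext => l; rewrite /H conj_Creal// realE !lecR sqrtr_ge0.
have -> : (fun l => (h l)%:C : R[i]^o) = (fun l => (H l : R[i]) * (H l : R[i])).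
  by apply/funext => l; rewrite /H -rmorphM -expr2 sqr_sqrtr.
by rewrite (fcalcM P Hc Hc) -{1}HJ (fcalc_star P Hc) Re_functional_ge0.
Qed.

(* Since [c] is nonnegative, [phi |l|] dominates [c * Re l + d] for all complex
   [l], so the spectrum of [y] need not be known to be nonnegative. *)
Lemma state_fcalc_ge f y b (phi : R -> R) (c d : R) :
  states f -> star y = y -> 0 <= c ->
  {within `[0, +oo[, continuous phi} ->
  (forall s, 0 <= s -> c * s + d <= phi s) ->
  fcalc_value phi y b -> c * complex.Re (f y) + d <= complex.Re (f b).
Proof.
move=> [fp f1] y_herm c0 phi_cont phi_ge [Phi P ->].
pose h l := phi (modulus l) + (- c * complex.Re l - d).
have h_ge0 l : 0 <= h l.
  rewrite /h mulNr -opprD subr_ge0.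
  apply: le_trans (phi_ge _ (modulus_ge0 l)).
  by rewrite lerD2r ler_wpM2l// Re_le_modulus.
have h_cont : continuous (h : R[i]^o -> R).
  move=> l; apply: (@cvgD _ _ _ _ (nbhs_filter l)).
    exact: (continuous_comp_modulus phi_cont).
  apply: (@cvgB _ _ _ _ (nbhs_filter l)); last exact: cvg_cst.
  by apply: (@cvgMr _ _ _ (nbhs_filter l)); exact: continuous_Re.
have := fcalc_ge0 P fp h_cont h_ge0.
have C1 : {within spectrum y,
    continuous (fun l : R[i]^o => (phi (modulus l))%:C : R[i]^o)}.
  apply: continuous_subspaceT => l; apply: continuous_comp; last first.
    exact: continuous_real_complex.
  exact: (continuous_comp_modulus phi_cont).
have Cid : {within spectrum y, continuous (id : R[i]^o -> R[i]^o)}.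
  by apply: continuous_subspaceT => l; exact: cvg_id.
have CJ : {within spectrum y,
    continuous (fun l : R[i]^o => Num.conj (l : R[i]) : R[i]^o)}.
  by apply: continuous_subspaceT; exact: continuous_conj.
have Cst : {within spectrum y, continuous (fun=> 1 : R[i]^o)}.
  by apply: continuous_subspaceT; exact: cst_continuous.
(* Writing the real part as half of [l] plus its conjugate reduces [h] to operations that [Phi]
   respects. *)
have -> : (fun l => (h l)%:C : R[i]^o) =
    (fun l => (phi (modulus l))%:C
       + ((- c / 2)%:C *: (l + Num.conj (l : R[i]) : R[i]^o)
          + (- d)%:C *: (1 : R[i]^o))).
  apply/funext => l; rewrite /h /GRing.scale /=.
  case: l => p q; apply/eqP; rewrite eq_complex /=.
  by apply/andP; split; apply/eqP; field.
have Cs (k : R[i]) (F : R[i]^o -> R[i]^o) : {within spectrum y, continuous F} ->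
    {within spectrum y, continuous (fun l => k *: F l)}.
  by move=> Fc l; apply: cvgZr; exact: Fc.
have CidJ := within_continuousD Cid CJ.
have PidJ : Phi (fun l => l + Num.conj (l : R[i]) : R[i]^o) = y + y.
  rewrite (fcalcD P Cid CJ) (fcalc_id P) (fcalc_star P Cid).
  by rewrite (fcalc_id P) y_herm.
have C2 := Cs (- c / 2)%:C _ CidJ; have C3 := Cs (- d)%:C _ Cst.
rewrite (fcalcD P C1 (within_continuousD C2 C3)) (fcalcD P C2 C3).
rewrite (fcalcZ P _ CidJ) (fcalcZ P _ Cst) PidJ (fcalc1 P).
rewrite !linearD /= !linearZ /= /GRing.scale /= f1.
by case: (f y) (f (Phi _)) => [? ?] [? ?] /=; lra.
Qed.
End cstar.

(** * Convexity and support lines of Orlicz functions *)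

Lemma convex_function_real (R : realType) (phi : R -> R) (t u v : R) :
  convex_function (`[0, +oo[%classic : set R) phi -> 0 <= t <= 1 ->
  0 <= u -> 0 <= v ->
  phi (t * u + (1 - t) * v) <= t * phi u + (1 - t) * phi v.
Proof.
move=> cvx /andP[t0 t1] u0 v0.
have := cvx (Itv01 t0 t1) u v; rewrite !convRE; apply;
  by rewrite inE /= in_itv /= andbT.
Qed.

(* The slope is the left derivative at [t], or 0 if [t = 0]. *)
Lemma orlicz_support_line (R : realType) (phi : R -> R) (t : R) :
  orlicz phi -> 0 <= t ->
  exists2 c, 0 <= c & forall s, 0 <= s -> phi t + c * (s - t) <= phi s.
Proof.
move=> [phi_ge0 _ cvx _ phi0 _ _]; rewrite le0r => /predU1P[-> | t0].
  by exists 0 => // s s0; rewrite mul0r addr0 phi0 phi_ge0.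
pose slopes := [set (phi t - phi s) / (t - s) | s in [set s | 0 <= s < t]].
have chord s u : 0 <= s < t -> t < u ->
    (phi t - phi s) / (t - s) <= (phi u - phi t) / (u - t).
  move=> /andP[s0 st] tu; have su : s < u by exact: lt_trans tu.
  rewrite ler_pdivrMr ?subr_gt0// mulrAC ler_pdivlMr ?subr_gt0//.
  (* This is the weight of [s] when [t] is written as a convex combination of [s] and [u]. *)
  have k01 : 0 <= (u - t) / (u - s) <= 1.
    apply/andP; split; first by rewrite divr_ge0// subr_ge0 ltW.
    by rewrite ler_pdivrMr ?subr_gt0// mul1r lerD2l lerN2 ltW.
  have := convex_function_real cvx k01 s0 (le_trans s0 (ltW su)).
  have -> : (u - t) / (u - s) * s + (1 - (u - t) / (u - s)) * u = t.
    by field; rewrite subr_eq0 gt_eqF.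
  have -> : 1 - (u - t) / (u - s) = (t - s) / (u - s).
    by field; rewrite subr_eq0 gt_eqF.
  rewrite mulrAC [X in _ + X]mulrAC -mulrDl ler_pdivlMr ?subr_gt0//.
  by nra.
have slopes_sup : has_sup slopes.
  split.
    by exists ((phi t - phi 0) / (t - 0)); exists 0; rewrite //= lexx t0.
  exists ((phi (t + 1) - phi t) / (t + 1 - t)) => _ [s /= st <-].
  by apply: chord => //; rewrite ltrDl.
exists (sup slopes).
  (* The chord from 0 already has nonnegative slope, because [phi 0 = 0]. *)
  apply: (@le_trans _ _ ((phi t - phi 0) / (t - 0))).
    by rewrite phi0 !subr0 divr_ge0// ?phi_ge0// ltW.
  by apply: sup_upper_bound => //; exists 0; rewrite //= lexx t0.
move=> s s0; have [st | ts | ->] := ltgtP s t; last first.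
- by rewrite subrr mulr0 addr0.
- have : sup slopes <= (phi s - phi t) / (s - t).
    apply: sup_le_ub; first exact: slopes_sup.1.
    by move=> _ [r /= rt <-]; exact: chord.
  by rewrite ler_pdivlMr ?subr_gt0//; nra.
- have : (phi t - phi s) / (t - s) <= sup slopes.
    by apply: sup_upper_bound => //; exists s; rewrite //= s0 st.
  by rewrite ler_pdivrMr ?subr_gt0//; nra.
Qed.

(** * The Orlicz inequality for the numerical radius *)

Section cstar_numradius.
Variables (R : realType) (A : cstarAlgType R).

Lemma orlicz_numradius_le (x y z : A) (phi : R -> R) (t : R) :
  orlicz phi -> 0 <= t <= 1 ->
  fcalc_value phi (star x * x) y -> fcalc_value phi (x * star x) z ->
  phi (numradius x ^+ 2) <= cnorm (t%:C *: y + (1 - t)%:C *: z).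
Proof.
move=> phiO /andP[t0 t1] Hy Hz; set w := _ + _; set r := numradius x.
have [c c0 line] := orlicz_support_line phiO (sqr_ge0 r).
have key g : states g ->
    phi (r ^+ 2) + c * (modulus (g x) ^+ 2 - r ^+ 2) <= cnorm w.
  move=> gs; apply: le_trans (state_contractive w gs).
  apply: le_trans (Re_le_modulus _); rewrite Re_functional_mix.
  have line' s : 0 <= s -> c * s + (phi (r ^+ 2) - c * r ^+ 2) <= phi s.
    by move=> /line; lra.
  have := state_fcalc_ge gs _ c0 (orlicz_continuous phiO) line' Hy.
  have := state_fcalc_ge gs _ c0 (orlicz_continuous phiO) line' Hz.
  rewrite !starM !starK => /(_ erefl) hz /(_ erefl) hy.
  have hx := ler_wpM2l c0 (state_sqr_le x gs).
  have hx' := ler_wpM2l c0 (state_sqr_le_adj x gs).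
  by nra.
rewrite leNgt; apply/negP; rewrite -subr_gt0; set d := _ - _ => d0.
have [S_sup|S_nsup] := pselect (has_sup [set modulus (g x) | g in @states R A]).
  have [_ [g0 g0s _]] := S_sup.1.
  have r0 : 0 <= r.
    apply: le_trans (modulus_ge0 (g0 x)) _.
    by apply: sup_upper_bound => //; exists g0.
  (* If [c] were 0, [key] at the single state [g0] would contradict [d0]. With [c] positive, every
     squared modulus stays below [r ^+ 2] by the fixed gap [d / c], which is impossible for a
     supremum. *)
  have c_gt0 : 0 < c.
    rewrite lt_neqAle c0 andbT; apply/eqP => c_eq0.
    by have := key _ g0s; rewrite -c_eq0 mul0r addr0 leNgt -subr_gt0 d0.
  have gx g : states g -> modulus (g x) ^+ 2 <= r ^+ 2 - d / c.
    move=> /key h; rewrite lerBrDl -lerBrDr ler_pdivrMr//.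
    by rewrite /d; lra.
  have rd : 0 <= r ^+ 2 - d / c := le_trans (sqr_ge0 _) (gx _ g0s).
  have : r <= Num.sqrt (r ^+ 2 - d / c).
    apply: sup_le_ub; first exact: S_sup.1.
    move=> _ [g /gx gs <-].
    by rewrite -(ger0_norm (modulus_ge0 _)) -sqrtr_sqr ler_wsqrtr.
  rewrite -(@ler_pXn2r _ 2)// ?nnegrE ?sqrtr_ge0// sqr_sqrtr//.
  by rewrite leNgt ltrBlDr ltrDl divr_gt0.
(* Without a supremum, e.g. when there are no states, [numradius x] is 0. *)
have := cnorm_ge0 w; move: d0; rewrite /d /r /numradius sup_out//.
by rewrite expr0n /= (orlicz0 phiO); lra.
Qed.
End cstar_numradius.

Theorem theorem2p13 (R : realType) (A : cstarAlgType R) (a : A) (alpha : R)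
    (a_neq0 : a != 0) (a_pos : positive_elt a) (alpha01 : 0 <= alpha <= 1) :
  (forall x xs : A, aadjointable a x -> aadjoint a x xs ->
     (anumradius a x ^+ 2
        <= anorm a (alpha%:C *: (xs * x) + (1 - alpha)%:C *: (x * xs))%R)%E)
  /\
  (forall (x : A) (phi : R -> R), orlicz phi ->
     forall y z : A,
       fcalc_value phi (star x * x) y -> fcalc_value phi (x * star x) z ->
       phi (numradius x ^+ 2)
         <= cnorm (alpha%:C *: y + (1 - alpha)%:C *: z)).
Proof.
split=> [x xs _ axs | x phi phiO y z Hy Hz].
  exact: anumradius_sqr_le.
exact: orlicz_numradius_le.
Qed.
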